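(* Let $Y$ be a topological vector space and let $C\subset Y$ be a non-trivial closed convex pointed cone with nonempty algebraic interior $\operatorname{core}C$. Then $\operatorname{core}C$ is the interior of $C$ in some norm topology of $Y$; that is, there exists a norm on the vector space $Y$ such that $\operatorname{core}C$ equals the interior of $C$ with respect to the topology generated by this norm.
   Context: Vector spaces are real. A set $C$ is a cone if $\lambda c\in C$ for all $\lambda\ge0$, $c\in C$; it is non-trivial if $C\neq\{0\}$ and $C\neq Y$ (and nonempty), and pointed if $C\cap(-C)=\{0\}$. $\operatorname{core}C$ denotes the algebraic interior of $C$. *)

(* Defs.v *)
From HB Require Import structures.
From mathcomp Require Import all_boot all_order all_algebra.
From mathcomp Require Import boolp classical_sets reals topology convex normedtype.

Set Implicit Arguments.
Unset Strict Implicit.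
Unset Printing Implicit Defensive.

Import Order.TTheory GRing.Theory Num.Theory.

Local Open Scope classical_set_scope.
Local Open Scope ring_scope.

Section Cones.
Context {R : realType} {Y : lmodType R}.
Implicit Types C : set Y.

Definition is_cone C := forall (l : R) (c : Y), 0 <= l -> C c -> C (l *: c).

Definition nontrivial_cone C :=
  [/\ is_cone C, C !=set0, C <> [set 0] & C <> setT].

Definition pointed_cone C := C `&` [set - c | c in C] = [set 0].

Definition core C : set Y :=
  [set c | C c /\ forall v : Y, exists2 e : R, 0 < e &
    forall t : R, 0 <= t <= e -> C (c + t *: v)].

End Cones.

Record vnorm (R : realType) (Y : lmodType R) := VNorm {
  vnorm_fun :> Y -> R;
  vnormD : forall x y, vnorm_fun (x + y) <= vnorm_fun x + vnorm_fun y;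
  vnormZ : forall (l : R) x, vnorm_fun (l *: x) = `|l| * vnorm_fun x;
  vnorm_eq0 : forall x, vnorm_fun x = 0 -> x = 0
}.

(* Copy of the vector space Y carrying the norm N and its topology; any
   topology that Y may already have is deliberately not inherited. *)
Definition normed_by (R : realType) (Y : lmodType R) (N : vnorm Y) : Type := Y.

Section NormedBy.
Context {R : realType} {Y : lmodType R} (N : vnorm Y).

HB.instance Definition _ := GRing.Lmodule.copy (normed_by N) Y.

HB.instance Definition _ := Lmodule_isNormed.Build R (normed_by N)
  (@vnormD R Y N) (@vnormZ R Y N) (@vnorm_eq0 R Y N).

End NormedBy.

Definition norm_interior (R : realType) (Y : lmodType R) (N : vnorm Y)
  (C : set Y) : set Y := @interior (normed_by N) C.

(* Main.v *)
Require Import Defs.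
From mathcomp Require Import all_boot all_order all_algebra.
From mathcomp Require Import boolp classical_sets reals topology convex normedtype.
From mathcomp Require Import interval_inference.

Set Implicit Arguments.
Unset Strict Implicit.
Unset Printing Implicit Defensive.

Import Order.TTheory GRing.Theory Num.Theory.

Local Open Scope classical_set_scope.
Local Open Scope ring_scope.

(** Fix a core point [u] of [C]. It is an order unit: every vector [y] satisfies
    [t u + y \in C] and [t u - y \in C] for some [t >= 0]. The norm sought is the
    Minkowski functional of the order interval between [- u] and [u]: [N y] is
    the infimum of those [t]. Closedness of [C] makes the infimum attained, as
    [t |-> t u + y] is continuous, so [N y u + y] and [N y u - y] always belong
    to [C] ([order_unit_norm_attained]). The norm axioms then follow from the
    minimality of [N y]; in particular [N y = 0] puts both [y] and [- y] in [C],
    whence [y = 0] because [C] is pointed.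

    A vector of the ball of radius [e] around [c] has the form [c - y] with
    [e u - y \in C]. If [c] is a core point, moving from [c] in the direction
    [- u] gives [c - e u \in C] for some [e > 0], and
    [c - y = (c - e u) + (e u - y)] shows that this ball lies in [C]
    ([core_sub_norm_interior]). The converse inclusion holds for any norm: a
    segment issued from [c] stays for a while in a given ball around [c]
    ([norm_interior_sub_core]). *)

Lemma convex_cone_add (R : realType) (Y : lmodType R) (C : set Y) :
  is_cone C -> convex_set (C : set (convex_lmodType Y)) ->
  forall x y, C x -> C y -> C (x + y).
Proof.
move=> coneC convC x y Cx Cy.
have h0 : (0 : R) <= 2^-1 by rewrite invr_ge0.
have h1 : (2^-1 : R) <= 1 by rewrite invf_le1 ?ler1n.
have /set_mem := convC x y (Itv01 h0 h1) (mem_set Cx) (mem_set Cy).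
rewrite /conv /= => Cm.
(* [x + y] is twice the midpoint of [x] and [y] *)
have := coneC 2 _ (ler0n _ _) Cm.
have -> : unstable.onem (2^-1 : R) = 2^-1.
  by rewrite /unstable.onem {1}[1]splitr mul1r addrK.
by rewrite -scalerDr scalerA divff ?scale1r.
Qed.

(** The preimage of [C] under the continuous map [t |-> t u + y] is closed. The
    topology of [Y] enters the construction of the norm through this property
    of rays alone. *)
Lemma closed_ray_endpoint (R : realType) (Y : topologicalLmodType R)
    (C : set Y) (u y : Y) (a : R) :
  closed C -> (forall t, a < t -> C (t *: u + y)) -> C (a *: u + y).
Proof.
move=> clC aC.
apply: (@closed_cvg _ _ (a^'+) _ (fun t : R => t *: u + y) C clC).
  by near=> t; apply: aC; near: t; exact: nbhs_right_gt.
apply: (@cvg_comp _ _ _ (fun t : R => (t *: u, y)) (fun z : Y * Y => z.1 + z.2)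
  _ (nbhs (a *: u, y))); last exact: (@add_continuous Y (a *: u, y)).
apply: cvg_pair; last exact: cvg_cst.
apply: (@cvg_comp _ _ _ (fun t : R => (t : R^o, u))
  (fun z : R^o * Y => z.1 *: z.2) _ (nbhs (a : R^o, u))); last first.
  exact: (@scale_continuous R Y (a, u)).
apply: (@cvg_pair _ R^o Y (a^'+) (nbhs (a : R^o)) (nbhs u)).
  exact: cvg_at_right_filter.
exact: cvg_cst.
Unshelve. all: by end_near.
Qed.

Section OrderUnitNorm.
Context {R : realType} {Y : lmodType R} (C : set Y) (u : Y).

Definition order_unit_bounds (y : Y) : set R :=
  [set t | [/\ 0 <= t, C (t *: u + y) & C (t *: u - y)]].

Definition order_unit_norm (y : Y) : R := inf (order_unit_bounds y).

Context (coneC : is_cone C) (addC : forall x y, C x -> C y -> C (x + y)).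
Context (coreu : core C u).

Lemma core_absorbs (y : Y) : exists2 t, 0 <= t & C (t *: u + y).
Proof.
have [_ /(_ y)[e e0 /(_ e)]] := coreu.
rewrite lexx ltW // => /(_ isT) Ce.
exists e^-1; first by rewrite invr_ge0 ltW.
have := coneC (l := e^-1) _ Ce; rewrite scalerDr scalerA mulVf ?gt_eqF //.
by rewrite scale1r; apply; rewrite invr_ge0 ltW.
Qed.

(** Since [u] itself lies in [C], admissible coefficients can be increased: this
    is how one passes from points close to an infimum to all larger values. *)
Lemma cone_upward (s t : R) (y : Y) :
  s <= t -> C (s *: u + y) -> C (t *: u + y).
Proof.
move=> st Cs; rewrite -(subrK s t) scalerDl -addrA; apply: addC => //.
by apply: coneC; [rewrite subr_ge0 | case: coreu].
Qed.

Lemma order_unit_bounds_neq0 (y : Y) : order_unit_bounds y !=set0.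
Proof.
have [s s0 Cs] := core_absorbs y; have [t t0 Ct] := core_absorbs (- y).
exists (s + t); split; first exact: addr_ge0.
- by apply: cone_upward Cs; rewrite lerDl.
- by apply: cone_upward Ct; rewrite lerDr.
Qed.

Lemma order_unit_norm_ge0 (y : Y) : 0 <= order_unit_norm y.
Proof. by apply: lb_le_inf (order_unit_bounds_neq0 y) _ => t []. Qed.

Lemma order_unit_norm_min (y : Y) (t : R) :
  order_unit_bounds y t -> order_unit_norm y <= t.
Proof. by move=> yt; apply: ge_inf => //; exists 0 => s []. Qed.

Context (rayC : forall (a : R) (y : Y),
  (forall t, a < t -> C (t *: u + y)) -> C (a *: u + y)).

Lemma order_unit_norm_attained (y : Y) :
  order_unit_bounds y (order_unit_norm y).
Proof.
split; first exact: order_unit_norm_ge0.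
- apply: rayC => t /(inf_lt (order_unit_bounds_neq0 y))[s [_ Cs _] /ltW st].
  exact: cone_upward Cs.
- apply: rayC => t /(inf_lt (order_unit_bounds_neq0 y))[s [_ _ Cs] /ltW st].
  exact: cone_upward Cs.
Qed.

Lemma order_unit_normD (x y : Y) :
  order_unit_norm (x + y) <= order_unit_norm x + order_unit_norm y.
Proof.
have [x0 Cx Cx'] := order_unit_norm_attained x.
have [y0 Cy Cy'] := order_unit_norm_attained y.
apply: order_unit_norm_min; split; first exact: addr_ge0.
- by rewrite scalerDl addrACA; exact: addC.
- by rewrite scalerDl opprD addrACA; exact: addC.
Qed.

Lemma order_unit_normZ_le (l : R) (x : Y) :
  order_unit_norm (l *: x) <= `|l| * order_unit_norm x.
Proof.
have [x0 Cx Cx'] := order_unit_norm_attained x.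
apply: order_unit_norm_min; split; first by rewrite mulr_ge0.
- have [l0|/ltW l0] := leP 0 l.
    by rewrite ger0_norm // -scalerA -scalerDr; exact: coneC.
  rewrite ler0_norm // -scalerA -[l in l *: x]opprK [X in _ + X]scaleNr.
  by rewrite -scalerBr; apply: coneC; rewrite ?oppr_ge0.
- have [l0|/ltW l0] := leP 0 l.
    by rewrite ger0_norm // -scalerA -scalerBr; exact: coneC.
  rewrite ler0_norm // -scalerA -[X in _ + X]scaleNr.
  by rewrite -scalerDr; apply: coneC; rewrite ?oppr_ge0.
Qed.

Lemma order_unit_normZ (l : R) (x : Y) :
  order_unit_norm (l *: x) = `|l| * order_unit_norm x.
Proof.
apply/eqP; rewrite eq_le order_unit_normZ_le /=.
have [->|l0] := eqVneq l 0; first by rewrite normr0 mul0r order_unit_norm_ge0.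
(* the reverse inequality is the direct one for [l^-1] and [l *: x] *)
have := order_unit_normZ_le l^-1 (l *: x).
by rewrite scalerA mulVf // scale1r normfV ler_pdivlMl ?normr_gt0.
Qed.

Context (pointC : pointed_cone C).

Lemma order_unit_norm_eq0 (x : Y) : order_unit_norm x = 0 -> x = 0.
Proof.
move=> x0; have [_] := order_unit_norm_attained x.
rewrite x0 scale0r !add0r => Cx CNx.
suff : (C `&` [set - c | c in C]) x by rewrite pointC.
by split=> //; exists (- x) => //; rewrite opprK.
Qed.

Definition order_unit_vnorm : vnorm Y :=
  VNorm order_unit_normD order_unit_normZ order_unit_norm_eq0.

Lemma core_sub_norm_interior : core C `<=` norm_interior order_unit_vnorm C.
Proof.
move=> c [_ /(_ (- u))[e e0 /(_ e)]]; rewrite lexx ltW // => /(_ isT) Ce.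
apply/(@nbhs_normP R (normed_by order_unit_vnorm)); exists e => // y /= ye.
have -> : y = (c + e *: - u) + (e *: u - (c - y)) :> Y.
  by rewrite scalerN addrA subrK opprB addrC subrK.
apply: addC => //; have [_ _] := order_unit_norm_attained (c - y).
by apply: cone_upward; exact: ltW.
Qed.

End OrderUnitNorm.

Lemma norm_interior_sub_core (R : realType) (Y : lmodType R) (N : vnorm Y)
  (C : set Y) : norm_interior N C `<=` core C.
Proof.
move=> c /(@nbhs_normP R (normed_by N))[r /= r0 rC].
have N0 v : 0 <= N v := normr_ge0 (v : normed_by N).
have near_c v : N v < r -> C (c + v).
  move=> vr; apply: rC; rewrite /= opprD addNKr.
  by rewrite (normrN (v : normed_by N)).
split.
  rewrite -[c]addr0; apply: near_c.
  by rewrite -(scale0r 0) vnormZ normr0 mul0r.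
move=> v.
(* [N v + 1] instead of [N v] avoids dividing by zero when [v = 0] *)
have Nv1 : 0 < N v + 1 by rewrite ltr_wpDl.
exists (r / (N v + 1)); first exact: divr_gt0.
move=> t /andP[t0 tr]; apply: near_c; rewrite vnormZ ger0_norm //.
apply: (@le_lt_trans _ _ (r / (N v + 1) * N v)); first exact: ler_wpM2r.
by rewrite mulrAC ltr_pdivrMr // ltr_pM2l // ltrDl.
Qed.

Theorem corollary9 (R : realType) (Y : topologicalLmodType R) (C : set Y) :
  nontrivial_cone C ->
  closed C ->
  convex_set (C : set (convex_lmodType Y)) ->
  pointed_cone C ->
  core C !=set0 ->
  exists N : vnorm Y, core C = norm_interior N C.
Proof.
move=> [coneC _ _ _] clC convC pointC [u coreu].
have addC := convex_cone_add coneC convC.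
have rayC a y := @closed_ray_endpoint R Y C u y a clC.
exists (order_unit_vnorm coneC addC coreu rayC pointC).
apply/seteqP; split; first exact: core_sub_norm_interior.
exact: norm_interior_sub_core.
Qed.
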